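(* For each of the ranking measures NDCG, AP and AUC with binary relevance vectors, the global observability condition fails when feedback is restricted to the top ranked item. That is, for each of these measures there is a number of items $m$ such that, for the associated loss (or gain) matrix $L$ and top-1 feedback matrix $H$, there are learner's actions $\sigma_i,\sigma_j$ with $$\ell_i-\ell_j\notin\bigoplus_{k\in[m!]}\mathrm{Col}(S_k^\top).$$
   Context: Items are numbered $1,\dots,m$. A permutation $\sigma$ maps ranks to items and $\sigma^{-1}$ maps items to ranks. The learner's actions are the $m!$ permutations $\sigma_1,\dots,\sigma_{m!}$; the adversary's actions are the binary vectors $R_1,\dots,R_{2^m}\in\{0,1\}^m$. Measures: $\mathrm{NDCG}(\sigma,R)=\frac1{Z(R)}\sum_{i=1}^m\frac{R(i)}{\log_2(1+\sigma^{-1}(i))}$ with $Z(R)=\max_\sigma\sum_{i=1}^m\frac{R(i)}{\log_2(1+\sigma^{-1}(i))}$ (gain); $\mathrm{AP}(\sigma,R)=\frac1{\|R\|_1}\sum_{i=1}^m\frac{\sum_{j\le i}\mathbb{1}(R(\sigma(j))=1)}{i}\mathbb{1}(R(\sigma(i))=1)$ (gain); $\mathrm{AUC}(\sigma,R)=\frac1{N(R)}\sum_{i=1}^m\sum_{j=1}^m\mathbb{1}(\sigma^{-1}(i)<\sigma^{-1}(j))\mathbb{1}(R(i)<R(j))$ with $N(R)=\|R\|_1(m-\|R\|_1)$ (loss). When the normalizer is $0$, the value is taken to be $1$ for NDCG and AP, and $0$ for AUC. $L\in\mathbb{R}^{m!\times2^m}$ has entries $L_{i,j}=$ the measure evaluated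 at $(\sigma_i,R_j)$, and $\ell_i$ is its $i$th row. $H_{i,j}=R_j(\sigma_i(1))$. Signal matrix of $\sigma_i$: $S_i\in\{0,1\}^{2\times2^m}$ with $(S_i)_{1,\ell}=\mathbb{1}(H_{i,\ell}=0)$, $(S_i)_{2,\ell}=\mathbb{1}(H_{i,\ell}=1)$. $\bigoplus_k\mathrm{Col}(S_k^\top)$ denotes the linear span of the columns of all $S_k^\top$. The global observability condition is that $\ell_i-\ell_j$ lies in this span for every pair of actions $\sigma_i,\sigma_j$. *)

(* Defs.v *)
From HB Require Import structures.
From mathcomp Require Import all_boot all_order all_algebra all_fingroup.
From mathcomp Require Import reals exp.

Set Implicit Arguments.
Unset Strict Implicit.
Unset Printing Implicit Defensive.

Import Order.TTheory GRing.Theory Num.Theory.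
Local Open Scope ring_scope.

(* Items and ranks are both 'I_m, numbered from 0: the rank i : 'I_m stands
   for the 1-based rank i.+1.  A permutation s : 'S_m maps ranks to items and
   s^-1 maps items to ranks. *)

Definition relevance (m : nat) := {ffun 'I_m -> bool}.

Lemma card_relevance (m : nat) : #|{ffun 'I_m -> bool}| = (2 ^ m)%N.
Proof. by rewrite card_ffun card_bool card_ord. Qed.

Definition learner_action (m : nat) (i : 'I_(m`!)) : 'S_m :=
  enum_val (cast_ord (esym (card_Sn m)) i).

Definition adversary_action (m : nat) (l : 'I_(2 ^ m)) : relevance m :=
  enum_val (cast_ord (esym (card_relevance m)) l).

Definition l1norm (m : nat) (v : relevance m) : nat := (\sum_(i < m) v i)%N.

Section Measures.
Variables (R : realType) (m : nat).
Implicit Types (s : 'S_m) (v : relevance m).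

Definition log2 (x : R) : R := ln x / ln 2.

Definition DCG s v : R :=
  \sum_(i < m) (v i)%:R / log2 (1 + ((s^-1)%g i).+1%:R).

(* Starting the maximum from the value at the identity permutation makes it
   exactly the maximum over 'S_m. *)
Definition DCG_max v : R := \big[Num.max/DCG 1%g v]_(s : 'S_m) DCG s v.

Definition NDCG s v : R :=
  if DCG_max v == 0 then 1 else (DCG_max v)^-1 * DCG s v.

Definition AP s v : R :=
  if l1norm v == 0%N then 1 else
  (l1norm v)%:R^-1 *
  \sum_(i < m) (\sum_(j < m | (j <= i)%N) (v (s j))%:R) / i.+1%:R
               * (v (s i))%:R.

Definition AUC_normalizer v : nat := (l1norm v * (m - l1norm v))%N.

Definition AUC s v : R :=
  if AUC_normalizer v == 0%N then 0 else
  (AUC_normalizer v)%:R^-1 *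
  \sum_(i < m) \sum_(j < m)
     (((s^-1)%g i < (s^-1)%g j)%N)%:R * ((v i < v j)%N)%:R.

End Measures.

Inductive ranking_measure := mNDCG | mAP | mAUC.

Definition eval_measure (R : realType) (mu : ranking_measure) (m : nat) :
    'S_m -> relevance m -> R :=
  match mu with
  | mNDCG => @NDCG R m
  | mAP => @AP R m
  | mAUC => @AUC R m
  end.

Definition measure_matrix (R : realType) (mu : ranking_measure) (m : nat) :
    'M[R]_(m`!, 2 ^ m) :=
  \matrix_(i, l) eval_measure R mu (learner_action i) (adversary_action l).

(* A top-ranked item exists only if there is at least one item, so the number
   of items is a successor here. *)
Definition top1_feedback (n : nat) : 'M[bool]_(n.+1`!, 2 ^ n.+1) :=
  \matrix_(i, l) adversary_action l (learner_action i ord0).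

(* Row 0 is the indicator of feedback 0, row 1 the indicator of feedback 1. *)
Definition signal_matrix (R : realType) (n : nat) (k : 'I_(n.+1`!)) :
    'M[R]_(2, 2 ^ n.+1) :=
  \matrix_(r, l) (nat_of_bool (top1_feedback n k l) == r)%:R.

(* The columns of the transposes of the signal matrices are the rows of the
   signal matrices; with vectors written as rows, their linear span is the sum
   of the row spaces. *)
Definition signal_span (R : realType) (n : nat) : 'M[R]_(2 ^ n.+1) :=
  (\sum_(k < n.+1`!) <<signal_matrix R k>>)%MS.

(* Main.v *)
(* The signal span consists of the functions of the relevance vector that are
   affine, so the mixed second difference in the relevances of two items, taken
   at 0, annihilates it.  With four items, it does not annihilate the row of the
   identity minus the row of the transposition of the first and the last item:
   for NDCG and AUC, because normalizing one and two relevant items takes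
   different constants; AP is already quadratic before normalization. *)
Require Import Defs.
From mathcomp Require Import all_boot all_order all_algebra all_fingroup.
From mathcomp Require Import reals exp.
From mathcomp Require Import ring lra.

Import Order.TTheory GRing.Theory Num.Theory.
Local Open Scope ring_scope.

Definition adversary_index {m : nat} (v : relevance m) : 'I_(2 ^ m) :=
  cast_ord (card_relevance m) (enum_rank v).

Definition learner_index {m : nat} (s : 'S_m) : 'I_(m`!) :=
  cast_ord (card_Sn m) (enum_rank s).

Lemma adversary_indexK m : cancel (@adversary_index m) (@adversary_action m).
Proof.
by move=> v; rewrite /adversary_action /adversary_index cast_ordK enum_rankK.
Qed.

Lemma learner_indexK m : cancel (@learner_index m) (@learner_action m).
Proof.
by move=> s; rewrite /learner_action /learner_index cast_ordK enum_rankK.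
Qed.

Definition indicator {m : nat} (A : {set 'I_m}) : relevance m :=
  [ffun i => i \in A].

Definition mixed_difference {R : realType} {m : nat} (a b : 'I_m)
    (f : relevance m -> R) : R :=
  f (indicator [set a; b]) - f (indicator [set a]) - f (indicator [set b])
  + f (indicator set0).

(** A row of a signal matrix is [v c] or [1 - v c], with [c] the item ranked first, so it depends on
    one relevance only; a mixed difference in two distinct items kills it. *)
Lemma signal_span_mixed_difference {R : realType} {n : nat} {a b : 'I_n.+1}
    {u : 'rV[R]_(2 ^ n.+1)} :
  a != b -> (u <= signal_span R n)%MS ->
  mixed_difference a b (fun v => u 0 (adversary_index v)) = 0.
Proof.
move=> neq_ab u_span.
(* The mixed difference becomes right multiplication by a column [w], so its vanishing on a span is
   inclusion in [kermx w] and need only be checked on the generators. *)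
pose d v : 'cV[R]_(2 ^ n.+1) := delta_mx (adversary_index v) 0.
pose w := d (indicator [set a; b]) - d (indicator [set a])
          - d (indicator [set b]) + d (indicator set0).
have wE p (M : 'M[R]_(p, 2 ^ n.+1)) i :
    (M *m w) i 0 = mixed_difference a b (fun v => M i (adversary_index v)).
  by rewrite /w mulmxDr !mulmxBr -!colE !mxE.
have /sub_kermxP/matrixP/(_ 0 0) : (u <= kermx w)%MS.
  apply: submx_trans u_span _; apply/sumsmx_subP => k _; rewrite genmxE.
  apply/sub_kermxP/matrixP => r j; rewrite (ord1 j) wE /mixed_difference.
  rewrite !mxE !adversary_indexK !ffunE !inE; set c := learner_action k ord0.
  have [->|] := eqVneq c a; first by rewrite (negbTE neq_ab) /=; ring.
  by case: (c == b) => _ /=; ring.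
by rewrite wE mxE.
Qed.

Definition first4 : 'I_4 := @Ordinal 4 0 isT.
Definition second4 : 'I_4 := @Ordinal 4 1 isT.
Definition third4 : 'I_4 := @Ordinal 4 2 isT.
Definition last4 : 'I_4 := @Ordinal 4 3 isT.

(** The predicate lets one rewriting rule also expand the inner sum of [AP], restricted to
    [j <= i]. *)
Lemma sum_ord4 (V : nmodType) (P : pred 'I_4) (F : 'I_4 -> V) :
  \sum_(i | P i) F i
  = (if P first4 then F first4 else 0) + (if P second4 then F second4 else 0)
    + (if P third4 then F third4 else 0) + (if P last4 then F last4 else 0).
Proof.
rewrite big_mkcond !big_ord_recr big_ord0 /= add0r.
by congr (_ + _ + _ + _); congr (if P _ then F _ else _); apply: val_inj.
Qed.

Lemma l1norm_indicator m (A : {set 'I_m}) : l1norm (indicator A) = #|A|.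
Proof.
rewrite /l1norm -sum1_card [RHS]big_mkcond; apply: eq_bigr => i _.
by rewrite ffunE; case: (i \in A).
Qed.

(** On both items, the first, the second and none, the differences of [AP] are 1/2, 3/4, 0 and 0; on
    the empty set the default values 1 cancel. *)
Lemma AP_mixed_difference (R : realType) :
  mixed_difference first4 second4
    (fun v => AP R 1%g v - AP R (tperm first4 last4) v) = - (1 / 4).
Proof.
rewrite /mixed_difference /AP !l1norm_indicator !cards1 cards0 cards2 /=.
rewrite !sum_ord4 /= !ffunE !inE !permE /=.
lra.
Qed.

(** In the same order, the differences of [AUC] are -3/4, -1, 0 and 0. *)
Lemma AUC_mixed_difference (R : realType) :
  mixed_difference first4 second4
    (fun v => AUC R 1%g v - AUC R (tperm first4 last4) v) = 1 / 4.
Proof.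
rewrite /mixed_difference /AUC /AUC_normalizer !l1norm_indicator.
rewrite !cards1 cards0 cards2 /= invg1 tpermV.
rewrite !sum_ord4 /= !ffunE !inE !permE /=.
rewrite -[(2 * (4 - 2))%N]/4%N -[(1 * (4 - 1))%N]/3%N; lra.
Qed.

Section NDCG.
Variable R : realType.

Lemma ln2_gt0 : 0 < ln 2 :> R.
Proof. by rewrite ln_gt0 // ltr1n. Qed.

Lemma log2_1p1 : log2 (1 + 1%:R : R) = 1.
Proof. by rewrite nat1r /log2 divff // gt_eqF // ln2_gt0. Qed.

Lemma log2_ge1 (k : nat) : 1 <= log2 (1 + k.+1%:R : R).
Proof.
rewrite /log2 ler_pdivlMr ?ln2_gt0 // mul1r ler_ln ?posrE ?ltr0n //.
  by rewrite nat1r ler_nat.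
by rewrite nat1r ltr0n.
Qed.

Lemma log2_gt1 (k : nat) : 1 < log2 (1 + k.+2%:R : R).
Proof.
rewrite /log2 ltr_pdivlMr ?ln2_gt0 // mul1r ltr_ln ?posrE ?ltr0n //.
  by rewrite nat1r ltr_nat.
by rewrite nat1r ltr0n.
Qed.

Lemma DCG_set0 m (s : 'S_m) : DCG R s (indicator set0) = 0.
Proof. by rewrite /DCG big1 // => i _; rewrite ffunE inE mul0r. Qed.

Lemma DCG_set1 m (s : 'S_m) (a : 'I_m) :
  DCG R s (indicator [set a]) = (log2 (1 + ((s^-1)%g a).+1%:R))^-1.
Proof.
rewrite /DCG (bigD1 a) //= big1 ?ffunE ?inE ?eqxx ?mul1r ?addr0 //.
by move=> i /negbTE neq_ia; rewrite ffunE inE neq_ia mul0r.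
Qed.

Lemma DCG_set2 m (s : 'S_m) (a b : 'I_m) : a != b ->
  DCG R s (indicator [set a; b])
  = DCG R s (indicator [set a]) + DCG R s (indicator [set b]).
Proof.
move=> neq_ab; rewrite /DCG -big_split; apply: eq_bigr => i _ /=.
rewrite !ffunE !inE -mulrDl; have [->|] := eqVneq i a.
  by rewrite (negbTE neq_ab) addr0.
by rewrite add0r.
Qed.

Lemma DCG_le_max {m} (s : 'S_m) (v : relevance m) : DCG R s v <= DCG_max R v.
Proof. exact: (le_bigmax _ (fun s => DCG R s v)). Qed.

Lemma DCG_max_set1 n (a : 'I_n.+1) : DCG_max R (indicator [set a]) = 1.
Proof.
have DCG_le1 s : DCG R s (indicator [set a]) <= 1.
  rewrite DCG_set1 invf_le1 ?log2_ge1 //.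
  exact: lt_le_trans ltr01 (log2_ge1 _).
apply/le_anti/andP; split; first exact: bigmax_le.
(* The bound 1 is attained by ranking [a] first, where the discount is [log2 2]. *)
apply: le_trans _ (DCG_le_max (tperm ord0 a) _).
by rewrite DCG_set1 tpermV tpermR log2_1p1 invr1.
Qed.

Lemma NDCG_mixed_difference :
  mixed_difference first4 second4
    (fun v => NDCG R 1%g v - NDCG R (tperm first4 last4) v) < 0.
Proof.
set t := tperm first4 last4.
have neq12 : first4 != second4 by [].
have DCG1_first : DCG R 1%g (indicator [set first4]) = 1.
  by rewrite DCG_set1 invg1 perm1 log2_1p1 invr1.
have DCG_second : DCG R t (indicator [set second4])
                  = DCG R 1%g (indicator [set second4]).
  by rewrite !DCG_set1 invg1 perm1 tpermV tpermD.
have DCGt_first : DCG R t (indicator [set first4]) < 1.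
  rewrite DCG_set1 tpermV tpermL invf_lt1 ?log2_gt1 //.
  exact: lt_trans ltr01 (log2_gt1 _).
have DCG1_second : 0 < DCG R 1%g (indicator [set second4]).
  by rewrite DCG_set1 invr_gt0 (lt_le_trans ltr01) ?log2_ge1.
have max_gt1 : 1 < DCG_max R (indicator [set first4; second4]).
  apply: lt_le_trans _ (DCG_le_max 1%g _).
  by rewrite DCG_set2 // DCG1_first ltrDl.
(* On the empty set both permutations thus get the default value 1, which cancels. *)
have max0 : DCG_max R (indicator (set0 : {set 'I_4})) = 0.
  by apply/le_anti/andP; split; [apply: bigmax_le => [|s _]|
    apply: le_trans _ (DCG_le_max 1%g _)]; rewrite DCG_set0.
rewrite /mixed_difference /NDCG !DCG_max_set1 max0 eqxx oner_eq0.
rewrite (gt_eqF (lt_trans ltr01 max_gt1)) !DCG_set2 // DCG_second DCG1_first.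
have : (DCG_max R (indicator [set first4; second4]))^-1 < 1.
  by rewrite invf_lt1 // (lt_trans ltr01).
rewrite invr1; move: (_^-1) (DCG R t _) DCGt_first => x d d_lt1 x_lt1.
(* The gain of the second item cancels, leaving [x * (1 - d) - (1 - d)], the opposite of this
   product; [x] is the inverse normalizer of the pair. *)
have : 0 < (1 - d) * (1 - x) by rewrite mulr_gt0 ?subr_gt0.
lra.
Qed.

End NDCG.

Theorem lemma12 (R : realType) (mu : ranking_measure) :
  exists (n : nat) (i j : 'I_(n.+1`!)),
    ~~ (row i (measure_matrix R mu n.+1) - row j (measure_matrix R mu n.+1)
          <= signal_span R n)%MS.
Proof.
(* The transposition demotes the first item to the last rank and leaves the second in place. *)
exists 3%N, (learner_index 1%g), (learner_index (tperm first4 last4)).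
apply/negP => /(signal_span_mixed_difference (isT : first4 != second4)).
rewrite /mixed_difference !mxE !adversary_indexK !learner_indexK.
case: mu => /= eq0.
- by have := NDCG_mixed_difference R; rewrite /mixed_difference eq0 ltxx.
- by have := AP_mixed_difference R; rewrite /mixed_difference eq0; lra.
- by have := AUC_mixed_difference R; rewrite /mixed_difference eq0; lra.
Qed.
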